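(* Let $G=(V,E)$ be a finite simple graph of order $n$. If $Z(D_t(G,x))=\{-1,0\}$, then $G$ has at least two support vertices.
   Context: A leaf is a vertex of degree one; a support vertex is a vertex adjacent to a leaf. For a finite simple graph $G=(V,E)$, a set $D\subseteq V$ is a total dominating set if every vertex of $V$ is adjacent to some vertex of $D$. $d_t(G,i)$ is the number of total dominating sets of $G$ of cardinality $i$, and $D_t(G,x)=\sum_i d_t(G,i)x^i$ is the total domination polynomial. $Z(D_t(G,x))$ denotes the set of distinct (complex) roots of $D_t(G,x)$. *)

(* Defs.v *)
From HB Require Import structures.
From mathcomp Require Import all_boot all_order all_algebra.
From mathcomp Require Import classical_sets reals.
From mathcomp.real_closed Require Import complex.

Set Implicit Arguments.
Unset Strict Implicit.
Unset Printing Implicit Defensive.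

Import Order.TTheory GRing.Theory Num.Theory.
Local Open Scope ring_scope.

Section TotalDomination.

(* A finite simple graph is a finite vertex type V with an adjacency relation,
   to be assumed symmetric and irreflexive wherever the graph is introduced. *)
Variables (V : finType) (adj : rel V).

Definition neighborhood (v : V) : {set V} := [set w | adj v w]%SET.

Definition leaf (v : V) : bool := #|neighborhood v| == 1%N.

Definition support_vertex (v : V) : bool := [exists u, adj v u && leaf u].

Definition total_dominating (D : {set V}) : bool :=
  [forall v, exists u in D, adj v u].

Definition dt (i : nat) : nat :=
  #|[set D : {set V} | total_dominating D & #|D| == i]%SET|.

Definition total_dom_poly : {poly int} :=
  \sum_(i < #|V|.+1) (dt i)%:Z *: 'X^i.

Definition total_dom_roots (R : realType) : set R[i] :=
  [set z | root (map_poly intr total_dom_poly) z]%classic.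

End TotalDomination.

Arguments total_dom_roots {V} adj R _ : assert.

(* Main.v *)
Require Import Defs.
From HB Require Import structures.
From mathcomp Require Import all_boot all_order all_algebra.
From mathcomp Require Import classical_sets reals.
From mathcomp.real_closed Require Import complex.

(** The polynomial is monic of degree n, and since a total dominating set is
    nonempty and never a singleton, 0 is a root of multiplicity at least 2.
    All other roots being -1 or 0, Vieta bounds the coefficient of X^(n-1) by
    n - 2.  This coefficient counts the vertices whose removal from V leaves a
    total dominating set, and every non-support vertex is one of these. *)

Set Implicit Arguments.
Unset Strict Implicit.
Unset Printing Implicit Defensive.

Import Order.TTheory GRing.Theory Num.Theory.
Local Open Scope ring_scope.

Section TotalDominationFacts.

(* Gives the finite-set readings of subsetP, set0, setT, ... precedence over
   those of classical_sets. *)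
Import fintype boot.finset.

Variables (V : finType) (adj : rel V).

Lemma total_dominatingS (A B : {set V}) :
  A \subset B -> total_dominating adj A -> total_dominating adj B.
Proof.
move=> sAB /forallP domA; apply/forallP => v.
have /existsP[u /andP[uA vu]] := domA v.
by apply/existsP; exists u; rewrite (subsetP sAB).
Qed.

Lemma dt_gt0P (i : nat) :
  reflect (exists2 D : {set V}, total_dominating adj D & #|D| = i)
          (0 < dt adj i)%N.
Proof.
apply: (iffP card_gt0P) => [[D]|[D domD cardD]].
  by rewrite inE => /andP[domD /eqP cardD]; exists D.
by exists D; rewrite inE domD cardD /=.
Qed.

(** With no vertices, the empty set dominates vacuously. This serves to exclude the empty graph, for
    which 0 would not be a root. *)
Lemma dt0_gt0 : #|V| = 0%N -> (0 < dt adj 0)%N.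
Proof.
move=> /card0_eq V0; apply/dt_gt0P; exists set0; last exact: cards0.
by apply/forallP => v; have := V0 v; rewrite inE.
Qed.

Lemma dt0 : (0 < #|V|)%N -> dt adj 0 = 0%N.
Proof.
move=> /card_gt0P[v _]; apply/eqP; rewrite -leqn0 leqNgt.
apply/negP => /dt_gt0P[D /forallP/(_ v)/existsP[u /andP[uD _]] /cards0_eq D0].
by rewrite D0 inE in uD.
Qed.

Lemma dt1 : irreflexive adj -> dt adj 1 = 0%N.
Proof.
move=> irr; apply/eqP; rewrite -leqn0 leqNgt.
apply/negP => /dt_gt0P[D /forallP domD /eqP/cards1P[v Dv]].
have /existsP[u] := domD v.
by rewrite Dv inE => /andP[/eqP ->]; rewrite irr.
Qed.

Lemma dt_card : total_dominating adj setT -> dt adj #|V| = 1%N.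
Proof.
move=> domV; rewrite /dt -(cards1 (setT : {set V})); congr #|pred_of_set _|.
apply/setP => D; rewrite !inE; apply/andP/eqP => [[_ cardD]|->].
  by apply/eqP; rewrite eqEcard subsetT cardsT (eqP cardD) leqnn.
by rewrite domV cardsT.
Qed.

(** If some [u] has no neighbor outside [v], then [v] is its only neighbor, so [u] is a leaf and [v]
    a support vertex. *)
Lemma total_dominating_setC1 (v : V) :
  symmetric adj -> total_dominating adj setT -> ~~ support_vertex adj v ->
  total_dominating adj [set~ v].
Proof.
move=> sym /forallP domV nsupp; apply/forallP => u.
apply: contraNT nsupp; rewrite negb_exists => /forallP nadj.
have adj_v w : adj u w -> w = v.
  by move=> uw; have := nadj w; rewrite !inE uw andbT negbK => /eqP.
have /existsP[w /andP[_ uw]] := domV u.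
have uv : adj u v by rewrite -(adj_v w uw).
apply/existsP; exists u; rewrite sym uv /=; apply/cards1P; exists v.
by apply/setP => x; rewrite !inE; apply/idP/eqP => [/adj_v|->].
Qed.

Lemma leq_card_nonsupport_dt :
  symmetric adj -> total_dominating adj setT ->
  (#|~: [set v | support_vertex adj v]| <= dt adj #|V|.-1)%N.
Proof.
move=> sym domV; have inj : injective (fun v : V => [set~ v]).
  by move=> u v /setC_inj/set1_inj.
rewrite -(card_imset _ inj); apply/subset_leq_card/subsetP => D.
case/imsetP => v; rewrite !inE => nsupp ->.
by rewrite total_dominating_setC1 //= cardsC1.
Qed.

Lemma total_dom_polyE :
  total_dom_poly adj = \poly_(i < #|V|.+1) (dt adj i)%:Z.
Proof. by rewrite poly_def. Qed.

Lemma coef_total_dom_poly (i : nat) :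
  (total_dom_poly adj)`_i = (dt adj i)%:Z.
Proof.
rewrite total_dom_polyE coef_poly; case: ltnP => // ltVi.
(* Beyond the truncation, [dt] vanishes because no set has more than [#|V|] elements. *)
case: (posnP (dt adj i)) => [->//|/dt_gt0P[D _ cardD]].
by have := max_card (mem D); rewrite cardD leqNgt ltVi.
Qed.

(** Total domination passes to supersets, so if all of [V] fails, every set fails and all
    coefficients vanish. *)
Lemma total_dominating_setT :
  total_dom_poly adj != 0 -> total_dominating adj setT.
Proof.
apply: contraNT => ndomV; apply/eqP/polyP => i.
rewrite coef0 coef_total_dom_poly.
case: (posnP (dt adj i)) => [->//|/dt_gt0P[D domD _]].
by rewrite (total_dominatingS (subsetT D) domD) in ndomV.
Qed.

Lemma size_total_dom_poly :
  total_dominating adj setT -> size (total_dom_poly adj) = #|V|.+1.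
Proof.
by move=> domV; rewrite total_dom_polyE size_poly_eq // dt_card.
Qed.

End TotalDominationFacts.

Lemma coefPn_le_roots_N1_0 (F : numClosedFieldType) (p : {poly F}) (n : nat) :
  p \is monic -> size p = n.+1 -> p`_0 = 0 -> p`_1 = 0 ->
  (forall z, root p z -> z = -1 \/ z = 0) ->
  (1 < n)%N /\ p`_n.-1 <= (n - 2)%:R.
Proof.
move=> /monicP lead_p size_p p0 p1 rootsP.
have [r def_p] := closed_field_poly_normal p.
rewrite lead_p scale1r in def_p.
have size_r : size r = n.
  by apply: succn_inj; rewrite -size_p def_p size_prod_XsubC.
have root_r z : root p z = (z \in r) by rewrite def_p root_prod_XsubC.
have r0 : 0 \in r by rewrite -root_r rootE horner_coef0 p0.
pose r1 := rem 0 r; have perm_r := perm_to_rem r0.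
have def_p1 : p = (\prod_(z <- r1) ('X - z%:P)) * 'X.
  by rewrite def_p (perm_big _ perm_r) big_cons subr0 mulrC.
have r10 : 0 \in r1.
  move: p1; rewrite def_p1 coefMX /= -horner_coef0.
  by rewrite -root_prod_XsubC rootE => ->.
pose r2 := rem 0 r1; have perm_r1 := perm_to_rem r10.
have size_r2 : n = (size r2).+2.
  by rewrite -size_r (perm_size perm_r) /= (perm_size perm_r1).
split; first by rewrite size_r2.
rewrite def_p -size_r coefPn_prod_XsubC ?size_r ?size_r2 //.
rewrite (perm_big _ perm_r) big_cons (perm_big _ perm_r1) big_cons /=.
rewrite !add0r -/r2.
(* Writing the bound as a sum of ones reduces it to [- z <= 1] for each remaining root. *)
have -> : (((size r2).+2 - 2)%:R : F) = \sum_(z <- r2) 1.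
  by rewrite big_const_seq count_predT iter_addr_0 subn2.
rewrite -sumrN !big_seq; apply: ler_sum => z /mem_rem/mem_rem.
by rewrite -root_r => /rootsP[]->; rewrite ?opprK ?oppr0.
Qed.

Theorem theorem4p2 (R : realType) (n : nat) (V : finType) (adj : rel V)
    (adj_sym : symmetric adj) (adj_irr : irreflexive adj)
    (order_n : #|V| = n)
    (roots_eq : total_dom_roots adj R = [set -1; 0]%classic) :
  (2 <= #|[set v : V | support_vertex adj v]%SET|)%N.
Proof.
pose q : {poly R[i]} := map_poly intr (total_dom_poly adj).
have rootq z : root q z <-> z = -1 \/ z = 0.
  by have := congr1 (fun A => A z) roots_eq; rewrite /total_dom_roots /= => ->.
have coefq i : q`_i = (dt adj i)%:R.
  by rewrite coef_map coef_total_dom_poly.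
have q0 : q`_0 = 0.
  by have /rootP := (rootq 0).2 (or_intror erefl); rewrite horner_coef0.
have V_gt0 : (0 < #|V|)%N.
  rewrite lt0n; apply/eqP => /(dt0_gt0 adj).
  by rewrite lt0n -(pnatr_eq0 R[i]) -coefq q0 eqxx.
have domV : total_dominating adj finset.setT.
  apply: total_dominating_setT; apply/eqP => P0.
  (* A zero polynomial would also have 1 as a root, forcing 1 = -1 or 1 = 0. *)
  have /rootq[/eqP|/eqP] : root q 1 by rewrite /q P0 rmorph0 root0.
    by rewrite -addr_eq0 -mulr2n pnatr_eq0.
  by rewrite oner_eq0.
have size_q : size q = n.+1.
  by rewrite size_map_inj_poly ?size_total_dom_poly ?order_n //; apply: intr_inj.
have monic_q : q \is monic.
  by rewrite monicE lead_coefE size_q /= coefq -order_n dt_card.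
have q1 : q`_1 = 0 by rewrite coefq dt1.
have [n_gt1] := coefPn_le_roots_N1_0 monic_q size_q q0 q1 (fun z => (rootq z).1).
rewrite coefq ler_nat -order_n => dt_le.
have := leq_trans (leq_card_nonsupport_dt adj_sym domV) dt_le.
(* With s support vertices this reads n - s <= n - 2; cancelling n in truncated subtraction relies
   on [n_gt1]. *)
by rewrite cardsCs finset.setCK leq_sub2lE // order_n.
Qed.
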